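(* Let $\alpha,\beta,D>0$, let $\phi:\mathbb{R}^d\to\mathbb{R}$ be given by $$\phi(x)=\alpha\sum_{i=1}^d\Big((|x_i|+\beta)\ln\Big(\frac{|x_i|}{\beta}+1\Big)-|x_i|\Big),$$ and let $\mathcal{K}=\{x\in\mathbb{R}^d:\|x\|_1\le D\}$. Let $y\in\mathbb{R}^d$ with $\|y\|_1>D$, and let $x^*$ be the vector returned by the following procedure: let $p$ be a permutation of $\{1,\dots,d\}$ with $|y_{p(i)}|\le|y_{p(i+1)}|$ for all $i$; define $$\theta(j)=|y_{p(j)}|\big(D+(d-j+1)\beta\big)+\beta D-\beta\sum_{i\ge j}|y_{p(i)}|,$$ $$\rho=\min\{j:\theta(j)>0\},\qquad z=\frac{\sum_{i=\rho}^d(|y_{p(i)}|+\beta)}{D+(d-\rho+1)\beta},$$ and $$x_i^*=\max\Big\{\frac{|y_i|+\beta}{z}-\beta,\,0\Big\}\operatorname{sgn}(y_i),\qquad i=1,\dots,d.$$ Then $$x^*\in\arg\min_{x\in\mathcal{K}}\mathcal{B}_\phi(x,y).$$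
   Context: $\mathcal{B}_\phi(x,y)=\phi(x)-\phi(y)-\langle\nabla\phi(y),x-y\rangle$ is the Bregman divergence and $\|\cdot\|_1$ the $\ell_1$ norm. *)

(* Defs.v *)
From mathcomp Require Export all_boot all_order all_algebra perm.
From mathcomp Require Export all_classical all_reals all_analysis.
Export Order.TTheory GRing.Theory Num.Theory.
Export numFieldNormedType.Exports.

Set Implicit Arguments.
Unset Strict Implicit.
Unset Printing Implicit Defensive.

Local Open Scope classical_set_scope.
Local Open Scope ring_scope.

Definition dot (R : realType) (d : nat) (u v : 'rV[R]_d) : R :=
  \sum_(i < d) u ord0 i * v ord0 i.

Definition l1norm (R : realType) (d : nat) (x : 'rV[R]_d) : R :=
  \sum_(i < d) `|x ord0 i|.

Definition gradient (R : realType) (d : nat) (f : 'rV[R]_d -> R)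
    (y : 'rV[R]_d) : 'rV[R]_d :=
  \row_(i < d) 'D_(delta_mx ord0 i) f y.

Definition bregman (R : realType) (d : nat) (f : 'rV[R]_d -> R)
    (x y : 'rV[R]_d) : R :=
  f x - f y - dot (gradient f y) (x - y).

Definition argmin (R : realType) (T : Type) (K : set T) (f : T -> R) : set T :=
  [set x | K x /\ forall x', K x' -> f x <= f x'].

Definition phi (R : realType) (d : nat) (alpha beta : R) (x : 'rV[R]_d) : R :=
  alpha * \sum_(i < d) ((`|x ord0 i| + beta) * ln (`|x ord0 i| / beta + 1)
                        - `|x ord0 i|).

Definition l1ball (R : realType) (d : nat) (D : R) : set 'rV[R]_d :=
  [set x | l1norm x <= D].

Definition sorts_abs (R : realType) (d : nat) (y : 'rV[R]_d)
    (p : {perm 'I_d}) : Prop :=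
  forall i j : 'I_d, j = i.+1 :> nat -> `|y ord0 (p i)| <= `|y ord0 (p j)|.

(* Indices start at 0: the ordinal [j] stands for the 1-based index [j + 1],
   so the 1-based count [d - j + 1] is [d - j] here. *)
Definition theta (R : realType) (d : nat) (beta D : R) (y : 'rV[R]_d)
    (p : {perm 'I_d}) (j : 'I_d) : R :=
  `|y ord0 (p j)| * (D + (d - j)%:R * beta) + beta * D
  - beta * \sum_(i < d | (j <= i)%N) `|y ord0 (p i)|.

(* 0-based; the value is [d] if no index qualifies. *)
Definition rho (R : realType) (d : nat) (beta D : R) (y : 'rV[R]_d)
    (p : {perm 'I_d}) : nat :=
  \big[minn/d]_(j < d | 0 < theta beta D y p j) j.

Definition zcoef (R : realType) (d : nat) (beta D : R) (y : 'rV[R]_d)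
    (p : {perm 'I_d}) : R :=
  let r := rho beta D y p in
  (\sum_(i < d | (r <= i)%N) (`|y ord0 (p i)| + beta))
  / (D + (d - r)%:R * beta).

Definition xstar (R : realType) (d : nat) (beta D : R) (y : 'rV[R]_d)
    (p : {perm 'I_d}) : 'rV[R]_d :=
  \row_(i < d) (Num.max ((`|y ord0 i| + beta) / zcoef beta D y p - beta) 0
                * Num.sg (y ord0 i)).

(* Main.v *)
Require Import Defs.
From mathcomp Require Import ring lra zify.
Local Open Scope classical_set_scope.
Local Open Scope ring_scope.

(** Up to the factor [alpha], [phi] is the sum over the coordinates of the
    one-variable convex function [entropy beta], whose derivative is
    [slope beta t = sg t * ln (|t| / beta + 1)].  So the difference of the
    divergences of [x] and of a candidate [s] from [y] is a sum over
    coordinates, and the theorem is the sufficiency of the KKT conditions for a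
    separable convex function on the l1 ball: [s] is a minimiser as soon as
    [|s|_1 = D] and some multiplier [lambda >= 0] makes
    [slope y_i - slope s_i] a subgradient of [lambda * | . |] at [s_i] for
    every [i].

    The multiplier is [lambda = ln z].  In the variable [u = |t| + beta] the
    slope is [ln (u / beta)], so shifting the slope of [y_i] by [ln z] towards
    zero amounts to dividing [|y_i| + beta] by [z].  When this quotient drops
    below [beta], no point has the shifted slope and the truncation at [0]
    takes over ([slope_truncation]).

    That [|s|_1 = D] is the content of the definitions of [theta], [rho] and
    [z].  By [thetaE], [theta j > 0] says that the coordinate of rank [j] would
    survive the truncation if [z] were computed from the ranks [>= j].
    As [theta] is positive at [rho] and nonpositive at every smaller rank, the
    coordinates that survive for the actual [z] are exactly those of rank
    [>= rho] ([threshold_rho]), and [z] is the number for which their truncated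
    values sum to [D] ([sum_truncation]).  Finally [z >= 1], because for [z < 1]
    every truncated value would be at least [|y_i|] and their sum would exceed
    [D] ([zcoef_ge1]).

    The gradient of [phi] is obtained without differentiating [ln] and without
    treating the kink of [| . |] at [0] separately: a function with a
    continuous selection of subgradients is differentiable, with that
    selection as its derivative ([cvg_subgradient]), and the subgradient
    inequality is needed for the minimisation anyway. *)

(** * Subgradients and derivatives *)

Lemma sgr_mul_le_norm {R : realType} (a x : R) : Num.sg a * x <= `|x|.
Proof.
rewrite (le_trans (ler_norm _)) // normrM normr_sg.
by case: (a != 0); rewrite ?mul1r ?mul0r.
Qed.

Lemma sub_le_mul_ln {R : realType} {u v : R} : 0 < u -> 0 < v ->
  u - v <= u * (ln u - ln v).
Proof.
move=> u0 v0.
have h : ln (1 + (v / u - 1)) <= v / u - 1.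
  by apply: le_ln1Dx; rewrite ltrBrDl addrN divr_gt0.
rewrite addrC subrK ln_div // in h.
have := ler_wpM2l (ltW u0) h.
rewrite [X in _ <= X](_ : _ = v - u); first by lra.
by field; rewrite gt_eqF.
Qed.

(** The subgradient inequalities at [a] and at [h + a] enclose the difference
    quotient between [s a] and [s (h + a)]. *)
Lemma cvg_subgradient {R : realType} {g s : R -> R} {a : R} :
  (forall x y, s y * (x - y) <= g x - g y) -> {for a, continuous s} ->
  h^-1 *: (g (h + a) - g a) @[h --> 0^'] --> s a.
Proof.
move=> sub cs; apply/cvgrPdist_le => e e0.
have cs0 : s (h + a) @[h --> 0^'] --> s a.
  apply: cvg_within_filter.
  have ca : h + a @[h --> 0] --> a.
    by rewrite -{2}[a]add0r; apply: cvgD; [exact: cvg_id|exact: cvg_cst].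
  exact: cvg_comp ca cs.
have near_s : \forall h \near 0^', `|s a - s (h + a)| <= e.
  exact: cvgr_dist_le cs0 _ e0.
near=> h.
have h0 : h != 0 by near: h; exact: nbhs_dnbhs_neq.
have hs : `|s a - s (h + a)| <= e by near: h.
have lo := sub (h + a) a; have hi := sub a (h + a).
rewrite addrK in lo; rewrite opprD addrCA subrr addr0 in hi.
have eq_q : g (h + a) - g a = h * (h^-1 *: (g (h + a) - g a)).
  by rewrite /GRing.scale /= mulrA divff // mul1r.
rewrite eq_q in lo; rewrite -[g a - _]opprB eq_q in hi.
set q := _ *: _ in lo hi *.
apply: le_trans hs; case: (ltgtP 0 h) h0 => // h0 _.
- have sq : s a <= q by rewrite -(ler_pM2l h0) mulrC.
  have qs : q <= s (h + a) by rewrite -(ler_pM2l h0); lra.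
  by rewrite !ler0_norm; lra.
- have qs : q <= s a by rewrite -(ler_nM2l h0) mulrC.
  have sq : s (h + a) <= q by rewrite -(ler_nM2l h0); lra.
  by rewrite !ger0_norm; lra.
Unshelve. all: by end_near.
Qed.

(** * The one-variable summand of the potential *)

Definition entropy {R : realType} (beta t : R) : R :=
  (`|t| + beta) * ln (`|t| / beta + 1) - `|t|.

Definition slope {R : realType} (beta t : R) : R :=
  Num.sg t * ln (`|t| / beta + 1).

Lemma divD1_gt0 {R : realType} {beta : R} (t : R) :
  0 < beta -> 0 < `|t| / beta + 1.
Proof. by move=> b0; rewrite ltr_wpDl // divr_ge0 // ltW. Qed.

Lemma ln_divD1_ge0 {R : realType} {beta : R} (t : R) :
  0 < beta -> 0 <= ln (`|t| / beta + 1).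
Proof. by move=> b0; apply: ln_ge0; rewrite lerDr divr_ge0 // ltW. Qed.

Lemma ln_divD1 {R : realType} {beta : R} (t : R) : 0 < beta ->
  ln (`|t| / beta + 1) = ln (`|t| + beta) - ln beta.
Proof.
move=> b0; rewrite -ln_div ?posrE // ?ltr_wpDl //.
by congr ln; field; rewrite gt_eqF.
Qed.

(** With [u = |x| + beta] and [v = |y| + beta], the inequality along
    [|x|, |y|] is [u - v <= u * (ln u - ln v)]; the sign of [y] only helps,
    since [sg y * x <= |x|] while [sg y * y = |y|]. *)
Lemma entropy_subgradient {R : realType} {beta : R} (x y : R) : 0 < beta ->
  slope beta y * (x - y) <= entropy beta x - entropy beta y.
Proof.
move=> b0; rewrite /slope /entropy.
have ly := ln_divD1_ge0 y b0.
have xb : 0 < `|x| + beta by rewrite ltr_wpDl.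
have yb : 0 < `|y| + beta by rewrite ltr_wpDl.
have key := sub_le_mul_ln xb yb.
have proj := sgr_mul_le_norm y x.
have sy : Num.sg y * y = `|y| by rewrite -normrEsg.
apply: (@le_trans _ _ (ln (`|y| / beta + 1) * (`|x| - `|y|))).
  by rewrite mulrAC mulrBr sy mulrC ler_wpM2l // lerB.
rewrite !ln_divD1 //; lra.
Qed.

Lemma continuous_slope {R : realType} {beta : R} : 0 < beta ->
  continuous (slope beta).
Proof.
move=> b0 a.
(* The product with [sg] hides the continuity at 0; as a difference of two
   functions of the positive and negative parts the slope is visibly
   continuous. *)
pose half (x : R) : R := ln (Num.max x 0 / beta + 1).
have chalf : continuous half.
  move=> x; rewrite /half.
  apply: (@cvg_comp _ _ _ (fun x : R => Num.max x 0 / beta + 1) (@ln R) _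
           (nbhs (Num.max x 0 / beta + 1))).
    apply: cvgD; last exact: cvg_cst.
    apply: cvgM; last exact: cvg_cst.
    by apply: (@continuous_max R R (fun x => x) (fun=> 0)) => //; exact: cvg_cst.
  apply: continuous_ln; rewrite ltr_wpDl // divr_ge0 ?(ltW b0) //.
  by rewrite le_max lexx orbT.
have -> : slope beta = (fun x : R => half x - half (- x)).
  apply/funext => x; rewrite /slope /half.
  case: (ltgtP x 0) => x0.
  - rewrite ltr0_sg // ltr0_norm //.
    rewrite (max_idPl _) ?oppr_ge0 ?(ltW x0) //.
    by rewrite mul0r add0r ln1 mulN1r sub0r.
  - rewrite gtr0_sg // gtr0_norm //.
    rewrite [Num.max (- x) _](max_idPr _) ?oppr_le0 ?(ltW x0) //.
    by rewrite mul0r add0r ln1 mul1r subr0.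
  - by rewrite x0 oppr0 maxxx sgr0 mul0r subrr.
apply: cvgB; first exact: chalf.
apply: (@cvg_comp _ _ _ (fun x : R => - x) half _ (nbhs (- a))) (chalf _).
by apply: cvgN; exact: cvg_id.
Qed.

Lemma phiE {R : realType} {d : nat} (alpha beta : R) (x : 'rV[R]_d) :
  phi alpha beta x = alpha * \sum_(i < d) entropy beta (x ord0 i).
Proof. by []. Qed.

(** Along a basis vector only one summand varies, so the directional
    difference quotient of [phi] is that of [entropy]. *)
Lemma gradient_phi {R : realType} {d : nat} (alpha beta : R) (y : 'rV[R]_d)
    (i : 'I_d) : 0 < beta ->
  gradient (phi alpha beta) y ord0 i = alpha * slope beta (y ord0 i).
Proof.
move=> b0; rewrite mxE; apply: cvg_lim => //.
have diff (h : R) : phi alpha beta (h *: delta_mx ord0 i + y) - phi alpha beta y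
    = alpha * (entropy beta (h + y ord0 i) - entropy beta (y ord0 i)).
  rewrite !phiE -mulrBr -sumrB (bigD1 i) //= big1 ?addr0.
    by rewrite !mxE !eqxx mulr1.
  by move=> j /negPf ji; rewrite !mxE ji andbF mulr0 add0r subrr.
rewrite (_ : (fun h : R => _) = fun h : R =>
    alpha * (h^-1 *: (entropy beta (h + y ord0 i) - entropy beta (y ord0 i)))).
  apply: cvgM; first exact: cvg_cst.
  apply: cvg_subgradient; last exact: continuous_slope.
  by move=> *; exact: entropy_subgradient.
by apply/funext => h /=; rewrite diff /GRing.scale /= mulrCA.
Qed.

(** * The threshold index and the normaliser *)

Lemma sorts_abs_homo {R : realType} {d : nat} {y : 'rV[R]_d} {p : {perm 'I_d}} :
  sorts_abs y p ->
  forall i j : 'I_d, (i <= j)%N -> `|y ord0 (p i)| <= `|y ord0 (p j)|.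
Proof.
move=> hp i [j jd] /=; elim: j jd => [|j IH] jd ij.
  by rewrite (_ : i = Ordinal jd) //; apply: val_inj => /=; lia.
have [eq_ij|neq_ij] := eqVneq (i : nat) j.+1.
  by rewrite (_ : i = Ordinal jd) //; exact: val_inj.
have jd' : (j < d)%N by lia.
apply: (le_trans (IH jd' _)); first lia.
exact: hp.
Qed.

Lemma sumr_const_ge {R : realType} (d r : nat) (c : R) :
  \sum_(i < d | (r <= i)%N) c = (d - r)%:R * c.
Proof.
by rewrite mulr_natl -sumr_const_nat (big_geq_mkord r d xpredT (fun=> c)).
Qed.

(** In this form [0 < theta j] compares [|y_(p j)| + beta] with
    [beta * z_j], where [z_j] is the normaliser of the ranks [>= j]. *)
Lemma thetaE {R : realType} {d : nat} (beta D : R) (y : 'rV[R]_d)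
    (p : {perm 'I_d}) (j : 'I_d) :
  theta beta D y p j = (`|y ord0 (p j)| + beta) * (D + (d - j)%:R * beta)
    - beta * \sum_(i < d | (j <= i)%N) (`|y ord0 (p i)| + beta).
Proof. by rewrite /theta big_split /= sumr_const_ge; ring. Qed.

Lemma theta_last_gt0 {R : realType} {d : nat} {beta D : R} (y : 'rV[R]_d)
    (p : {perm 'I_d}) (j : 'I_d) : 0 < beta -> 0 < D -> j.+1 = d ->
  0 < theta beta D y p j.
Proof.
move=> b0 D0 jd.
rewrite thetaE (big_pred1 j) => [|i]; last first.
  by rewrite /= -val_eqE /=; have := ltn_ord i; lia.
rewrite (_ : (d - j)%N = 1) ?mul1r; last by lia.
rewrite [X in 0 < X](_ : _ = (`|y ord0 (p j)| + beta) * D); last by ring.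
by rewrite mulr_gt0 // ltr_wpDl.
Qed.

Lemma rho_le {R : realType} {d : nat} {beta D : R} {y : 'rV[R]_d}
    {p : {perm 'I_d}} (j : 'I_d) :
  0 < theta beta D y p j -> (rho beta D y p <= j)%N.
Proof.
exact: (@bigmin_le_cond _ nat _ d j (fun j => 0 < theta beta D y p j)).
Qed.

(** The largest entry always qualifies, so the default value [d] in the
    definition of [rho] is never taken. *)
Lemma rho_attained {R : realType} {d : nat} {beta D : R} (y : 'rV[R]_d)
    (p : {perm 'I_d}) : 0 < beta -> 0 < D -> (0 < d)%N ->
  exists2 j : 'I_d, rho beta D y p = j & 0 < theta beta D y p j.
Proof.
move=> b0 D0 d0.
have ld : (d.-1 < d)%N by rewrite prednK.
pose P (j : 'I_d) := 0 < theta beta D y p j.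
have Pl : P (Ordinal ld) by apply: theta_last_gt0 => //=; rewrite prednK.
have le_d (i : 'I_d) : P i -> ((i : nat) <= d)%O by rewrite leEnat => _; exact: ltnW.
have := @bigmin_eq_arg _ nat _ d _ P (fun j => j : nat) Pl le_d.
by case: arg_minP => // j Pj _ rhoE; exists j.
Qed.

Lemma zcoef_gt0 {R : realType} {d : nat} {beta D : R} (y : 'rV[R]_d)
    (p : {perm 'I_d}) : 0 < beta -> 0 < D -> (0 < d)%N ->
  0 < zcoef beta D y p.
Proof.
move=> b0 D0 d0; rewrite /zcoef.
have [j -> _] := rho_attained y p b0 D0 d0.
have b_gt0 (i : 'I_d) : 0 < `|y ord0 (p i)| + beta by rewrite ltr_wpDl.
rewrite divr_gt0 //; last by rewrite ltr_wpDr // mulr_ge0 // ltW.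
by rewrite (bigD1 j) //= ltr_wpDr // sumr_ge0 // => i _; exact: ltW.
Qed.

(** At and above [rho], use [theta rho > 0] and monotonicity.  Below [rho], by
    monotonicity it is enough to treat rank [rho - 1], where [theta <= 0] by
    minimality of [rho]: moving from [rho - 1] to [rho] removes
    [|y| + beta] from the sum and [beta] from the denominator of the
    normaliser, and these two changes cancel in the comparison with [beta]. *)
Lemma threshold_rho {R : realType} {d : nat} {beta D : R} {y : 'rV[R]_d}
    {p : {perm 'I_d}} (k : 'I_d) : 0 < beta -> 0 < D -> sorts_abs y p ->
  (beta < (`|y ord0 (p k)| + beta) / zcoef beta D y p)
  = (rho beta D y p <= k)%N.
Proof.
move=> b0 D0 hp; have d0 : (0 < d)%N by apply: leq_trans (ltn_ord k).
have z0 := zcoef_gt0 y p b0 D0 d0.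
have [j rj thj] := rho_attained y p b0 D0 d0.
rewrite ltr_pdivlMr //.
have w0 : 0 < D + (d - rho beta D y p)%:R * beta.
  by rewrite ltr_wpDr // mulr_ge0 // ltW.
rewrite {1}/zcoef mulrA ltr_pdivrMr //.
case: (leqP (rho beta D y p) k) => [rk|kr].
- rewrite thetaE subr_gt0 -rj in thj; apply: (lt_le_trans thj).
  by rewrite ler_pM2r // lerD2r sorts_abs_homo // -rj.
- apply/negbTE; rewrite -leNgt.
  have jd' : ((rho beta D y p).-1 < d)%N by rewrite rj; have := ltn_ord j; lia.
  pose j' := Ordinal jd'.
  have thj' : theta beta D y p j' <= 0.
    by rewrite leNgt; apply/negP => /rho_le /=; lia.
  have kj' : `|y ord0 (p k)| <= `|y ord0 (p j')|.
    by apply: sorts_abs_homo => //=; lia.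
  apply: (@le_trans _ _ ((`|y ord0 (p j')| + beta)
                         * (D + (d - rho beta D y p)%:R * beta))).
    by rewrite ler_pM2r // lerD2r.
  move: thj'; rewrite thetaE (bigD1 j') //=.
  rewrite (_ : (d - (rho beta D y p).-1)%N = (d - rho beta D y p).+1); last first.
    by rewrite rj; have := ltn_ord j; lia.
  rewrite (eq_bigl (fun i : 'I_d => rho beta D y p <= i)%N) => [|i]; last first.
    by rewrite -val_eqE /=; lia.
  by rewrite -natr1; lra.
Qed.

(** The terms of rank at least [rho] contribute
    [S / z - (d - rho) * beta], with [S] the numerator of [z]; this is [D] by
    the definition of [z]. *)
Lemma sum_truncation {R : realType} {d : nat} {beta D : R} {y : 'rV[R]_d}
    {p : {perm 'I_d}} : 0 < beta -> 0 < D -> (0 < d)%N -> sorts_abs y p ->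
  \sum_(i < d) Num.max ((`|y ord0 i| + beta) / zcoef beta D y p - beta) 0 = D.
Proof.
move=> b0 D0 d0 hp; have z0 := zcoef_gt0 y p b0 D0 d0.
rewrite (reindex_inj (@perm_inj _ p)) /=.
rewrite (bigID (fun i : 'I_d => rho beta D y p <= i)%N) /=.
rewrite [X in _ + X]big1 ?addr0 => [|i]; last first.
  by rewrite -(threshold_rho i b0 D0 hp) -leNgt => le_b; rewrite max_r // subr_le0.
under eq_bigr => i.
  rewrite -(threshold_rho i b0 D0 hp) => lt_b.
  rewrite max_l; last by rewrite subr_ge0 ltW.
  over.
rewrite sumrB -mulr_suml sumr_const_ge.
have w0 : 0 < D + (d - rho beta D y p)%:R * beta.
  by rewrite ltr_wpDr // mulr_ge0 // ltW.
have eqS : \sum_(i < d | (rho beta D y p <= i)%N) (`|y ord0 (p i)| + beta)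
    = zcoef beta D y p * (D + (d - rho beta D y p)%:R * beta).
  by rewrite /zcoef divfK // gt_eqF.
by rewrite eqS mulrAC divff ?gt_eqF // mul1r addrK.
Qed.

Lemma l1norm_gt_dim {R : realType} {d : nat} {D : R} {y : 'rV[R]_d} :
  0 <= D -> D < l1norm y -> (0 < d)%N.
Proof.
case: d y => // y D0; rewrite /l1norm big_ord0 => D_lt0.
by have := le_lt_trans D0 D_lt0; rewrite ltxx.
Qed.

(** If [z < 1], each truncated value is at least [|y_i|], so that
    [D = \sum_i max(...) >= l1norm y]. *)
Lemma zcoef_ge1 {R : realType} {d : nat} {beta D : R} {y : 'rV[R]_d}
    {p : {perm 'I_d}} : 0 < beta -> 0 < D -> D < l1norm y -> sorts_abs y p ->
  1 <= zcoef beta D y p.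
Proof.
move=> b0 D0 yD hp.
have d0 := l1norm_gt_dim (ltW D0) yD.
have z0 := zcoef_gt0 y p b0 D0 d0.
rewrite leNgt; apply/negP => z1; move: yD.
rewrite ltNge -(sum_truncation b0 D0 d0 hp) => /negP; apply.
apply: ler_sum => i _; rewrite le_max; apply/orP; left.
rewrite lerBrDr ler_pdivlMr // ler_piMr ?(ltW z1) //.
by rewrite addr_ge0 // ltW.
Qed.

(** The factor [sg (y_i)] could lose a positive truncated value only when
    [y_i = 0], and then [z >= 1] makes the truncated value vanish. *)
Lemma norm_xstar {R : realType} {d : nat} {beta D : R} (y : 'rV[R]_d)
    (p : {perm 'I_d}) (i : 'I_d) : 0 < beta -> 1 <= zcoef beta D y p ->
  `|xstar beta D y p ord0 i|
  = Num.max ((`|y ord0 i| + beta) / zcoef beta D y p - beta) 0.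
Proof.
move=> b0 z1; rewrite mxE normrM normr_sg.
rewrite ger0_norm; last by rewrite le_max lexx orbT.
case: eqVneq => [->|_]; last by rewrite mulr1.
rewrite mulr0 max_r // normr0 add0r subr_le0 ler_pdivrMr.
  by rewrite ler_peMr // ltW.
exact: lt_le_trans z1.
Qed.

(** * Optimality *)

(** The KKT condition for one coordinate: [slope a - slope s] is a subgradient
    of [ln z * | . |] at the truncated point [s].  Where the truncation is
    inactive, [slope a - slope s = sg s * ln z]; where [s = 0], it is at most
    [ln z] in absolute value. *)
Lemma slope_truncation {R : realType} {beta z : R} (a x : R) :
  0 < beta -> 1 <= z ->
  let s := Num.max ((`|a| + beta) / z - beta) 0 * Num.sg a in
  (slope beta a - slope beta s) * (x - s) <= ln z * (`|x| - `|s|).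
Proof.
move=> b0 z1; set s := (X in let _ := X in _) => /=.
have z0 : 0 < z by exact: lt_le_trans z1.
have lz : 0 <= ln z by exact: ln_ge0.
have ab : 0 < `|a| + beta by rewrite ltr_wpDl.
have sgx := sgr_mul_le_norm a x.
case: (leP ((`|a| + beta) / z) beta) => [le_b|lt_b].
- have s0 : s = 0 by rewrite /s max_r ?mul0r // subr_le0.
  rewrite s0 {2}/slope sgr0 mul0r !subr0 normr0 subr0 /slope mulrAC mulrC.
  have la := ln_divD1_ge0 a b0.
  apply: (le_trans (ler_wpM2l la sgx)); apply: ler_wpM2r => //.
  rewrite ler_ln ?posrE //; last exact: divD1_gt0.
  rewrite -(ler_pM2r b0) mulrDl divfK ?gt_eqF // mul1r.
  by rewrite mulrC -ler_pdivrMr.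
- have a0 : a != 0.
    apply: contraTneq lt_b => ->; rewrite normr0 add0r -leNgt.
    by rewrite ler_pdivrMr // ler_peMr // ltW.
  have c0 : 0 < (`|a| + beta) / z - beta by rewrite subr_gt0.
  have sE : s = ((`|a| + beta) / z - beta) * Num.sg a by rewrite /s max_l // ltW.
  have ns : `|s| = (`|a| + beta) / z - beta.
    by rewrite sE normrM normr_sg a0 mulr1 gtr0_norm.
  have sgs : Num.sg s = Num.sg a by rewrite sE sgrM gtr0_sg // mul1r sgr_id.
  have -> : slope beta a - slope beta s = Num.sg a * ln z.
    rewrite /slope sgs -mulrBr !ln_divD1 // ns subrK ln_div ?posrE //.
    by congr (_ * _); ring.
  rewrite mulrAC mulrC ler_wpM2l // mulrBr lerB //.
  by rewrite -sgs -normrEsg.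
Qed.

Theorem lemma5 (R : realType) (d : nat) (alpha beta D : R)
    (halpha : 0 < alpha) (hbeta : 0 < beta) (hD : 0 < D)
    (y : 'rV[R]_d) (hy : D < l1norm y)
    (p : {perm 'I_d}) (hp : sorts_abs y p) :
  argmin (@l1ball R d D) (fun x => bregman (phi alpha beta) x y)
    (xstar beta D y p).
Proof.
have z1 := zcoef_ge1 hbeta hD hy hp.
have d0 := l1norm_gt_dim (ltW hD) hy.
set xs := xstar beta D y p.
have norm_xs : l1norm xs = D.
  rewrite -[RHS](sum_truncation hbeta hD d0 hp); apply: eq_bigr => i _.
  exact: norm_xstar.
split=> [|x]; rewrite /l1ball /= ?norm_xs // => xD.
rewrite -subr_ge0 /bregman.
have -> : phi alpha beta x - phi alpha beta y
     - dot (gradient (phi alpha beta) y) (x - y)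
   - (phi alpha beta xs - phi alpha beta y
     - dot (gradient (phi alpha beta) y) (xs - y))
   = alpha * \sum_(i < d) (entropy beta (x ord0 i) - entropy beta (xs ord0 i)
       - slope beta (y ord0 i) * (x ord0 i - xs ord0 i)).
  have dotE u : dot (gradient (phi alpha beta) y) (u - y)
      = alpha * \sum_(i < d) slope beta (y ord0 i) * (u ord0 i - y ord0 i).
    rewrite mulr_sumr; apply: eq_bigr => i _.
    by rewrite gradient_phi // !mxE mulrA.
  rewrite !dotE !phiE !sumrB.
  rewrite [X in _ = _ * (_ - X)](_ : _ =
    \sum_(i < d) slope beta (y ord0 i) * (x ord0 i - y ord0 i)
    - \sum_(i < d) slope beta (y ord0 i) * (xs ord0 i - y ord0 i)); first by ring.
  by rewrite -sumrB; apply: eq_bigr => i _; ring.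
apply: mulr_ge0; first exact: ltW.
(* Summed over the coordinates, the bounds of [slope_truncation] leave
   [ln z * (D - l1norm x)], which is nonnegative on the ball. *)
apply: (@le_trans _ _ (\sum_(i < d) - (ln (zcoef beta D y p)
                                           * (`|x ord0 i| - `|xs ord0 i|)))).
  rewrite sumrN -mulr_sumr sumrB.
  rewrite -[X in X - _]/(l1norm x) -[X in _ - X]/(l1norm xs).
  by rewrite norm_xs -mulrN mulr_ge0 ?ln_ge0 // oppr_ge0 subr_le0.
apply: ler_sum => i _.
have sub := entropy_subgradient (x ord0 i) (xs ord0 i) hbeta.
have /= kkt := slope_truncation (y ord0 i) (x ord0 i) hbeta z1.
have xsE : xs ord0 i = Num.max ((`|y ord0 i| + beta) / zcoef beta D y p - beta) 0
   * Num.sg (y ord0 i) by rewrite mxE.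
rewrite -xsE in kkt; lra.
Qed.
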